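(* Let $(X,D,P)$ be a complete perturbed metric space with exact metric $d=D-P$. Let $T:X\to X$ and let $a,b,c,h,e\ge 0$ be such that for all $x,y\in X$ $$D(Tx,Ty)\le a\,D(x,y)+b\,D(x,Tx)+c\,D(y,Ty)+h\,D(x,Ty)+e\,D(y,Tx).$$ Let $a_0,b_0,c_0,h_0,e_0\ge 0$ be constants such that for all $x,y\in X$ $$a\,P(x,y)+b\,P(x,Tx)+c\,P(y,Ty)+h\,P(x,Ty)+e\,P(y,Tx)\le a_0\,d(x,y)+b_0\,d(x,Tx)+c_0\,d(y,Ty)+h_0\,d(x,Ty)+e_0\,d(y,Tx),$$ and suppose $(a+a_0)+(b+b_0)+(c+c_0)+(h+h_0)+(e+e_0)<1$. Put $A=a+a_0$, $B=b+b_0$, $C=c+c_0$, $H=h+h_0$, $E=e+e_0$, and let $x^\ast$ be the unique fixed point of $T$ (which exists under these hypotheses). Let $\widetilde T:X\to X$ be any mapping possessing at least one fixed point $\widetilde x$, and suppose that $\sup_{x\in X}D(Tx,\widetilde Tx)\le\eta$ for some real $\eta$. Then $$d(x^\ast,\widetilde x)\le\frac{1+C+H}{1-(A+H+E)}\;\eta.$$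
   Context: A perturbed metric space $(X,D,P)$ consists of a nonempty set $X$ and two functions $D,P:X\times X\to[0,\infty)$ such that $d(x,y):=D(x,y)-P(x,y)$ is a metric on $X$, called the exact metric. Neither $D$ nor $P$ is assumed symmetric. $(X,D,P)$ is called complete if the metric space $(X,d)$ is complete. *)

(* Defs.v *)
From HB Require Import structures.
From mathcomp Require Import all_boot all_order all_algebra.
From mathcomp Require Import all_classical all_reals all_analysis.

Set Implicit Arguments.
Unset Strict Implicit.
Unset Printing Implicit Defensive.

Import Order.TTheory GRing.Theory Num.Theory.

Local Open Scope classical_set_scope.
Local Open Scope ring_scope.

Record is_metric (R : realType) (X : Type) (d : X -> X -> R) : Prop := IsMetric {
  is_metric_ge0 : forall x y, 0 <= d x y ;
  is_metric_eq0 : forall x y, d x y = 0 <-> x = y ;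
  is_metric_sym : forall x y, d x y = d y x ;
  is_metric_triangle : forall x y z, d x z <= d x y + d y z
}.

Record perturbedMetricSpace (R : realType) := PerturbedMetricSpace {
  pms_carrier :> Type ;
  pms_D : pms_carrier -> pms_carrier -> R ;
  pms_P : pms_carrier -> pms_carrier -> R ;
  pms_nonempty : inhabited pms_carrier ;
  pms_D_ge0 : forall x y, 0 <= pms_D x y ;
  pms_P_ge0 : forall x y, 0 <= pms_P x y ;
  pms_exact : is_metric (fun x y => pms_D x y - pms_P x y)
}.

Section ExactMetric.
Context {R : realType} (M : perturbedMetricSpace R).

Definition exact_dist (x y : M) : R := pms_D x y - pms_P x y.

Lemma exact_distxx (x : M) : exact_dist x x = 0.
Proof. exact/(is_metric_eq0 (pms_exact M)). Qed.

Lemma exact_dist_positivity (x y : M) : exact_dist x y = 0 -> x = y.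
Proof. by move/(is_metric_eq0 (pms_exact M)). Qed.

Lemma exact_dist_sym (x y : M) : exact_dist x y = exact_dist y x.
Proof. exact: (is_metric_sym (pms_exact M)). Qed.

Lemma exact_dist_triangle (y x z : M) :
  exact_dist x z <= exact_dist x y + exact_dist y z.
Proof. exact: (is_metric_triangle (pms_exact M)). Qed.

HB.instance Definition _ := gen_eqMixin (pms_carrier M).
HB.instance Definition _ := gen_choiceMixin (pms_carrier M).

(* The topology and uniformity of M are those of the metric exact_dist, so
   that mdist on M is exact_dist by definition. *)
HB.instance Definition _ := isMetric.Build R (pms_carrier M)
  exact_distxx exact_dist_positivity exact_dist_sym exact_dist_triangle.

Lemma mdist_exact (x y : M) : mdist x y = exact_dist x y.
Proof. by []. Qed.

(* The axiom of completeType, except that completeType and cvg F require a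
   pointed type, hence the explicit limit. *)
Definition pms_complete : Prop :=
  forall F : set_system M, ProperFilter F -> cauchy F -> exists x : M, F --> x.

End ExactMetric.

(* Main.v *)
(** Since [d <= D], adding the two hypotheses gives a Hardy-Rogers contraction
    inequality for [d] with coefficients [A, B, C, H, E] of sum [< 1].  The
    classical Picard argument then yields the fixed point [xstar].  If
    [xt = Tt xt], then [d (T xt) xt <= D (T xt) (Tt xt) <= eta], and applying
    the contraction inequality to [xstar, xt] bounds [d xstar xt] by
    [(A + H + E) * d xstar xt + (1 + C + H) * eta]. *)

Require Import Defs.
From HB Require Import structures.
From mathcomp Require Import all_boot all_order all_algebra.
From mathcomp Require Import all_classical all_reals all_analysis.
From mathcomp Require Import lra.

Import Order.TTheory GRing.Theory Num.Theory.

Set Implicit Arguments.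
Unset Strict Implicit.

Local Open Scope classical_set_scope.
Local Open Scope ring_scope.

Definition hardy_rogers (R : realType) (M : metricType R) (T : M -> M)
    (A B C H E : R) : Prop :=
  [/\ [/\ 0 <= A, 0 <= B, 0 <= C, 0 <= H & 0 <= E],
    A + B + C + H + E < 1 &
    forall x y, mdist (T x) (T y) <= A * mdist x y + B * mdist x (T x)
      + C * mdist y (T y) + H * mdist x (T y) + E * mdist y (T x)].

(* Averaging the inequality at [(x, T x)] with the one at [(T x, x)] gives the
   ratio [(2 A + B + C + H + E) / (2 - (B + C + H + E))]. *)
Lemma hardy_rogers_step (R : realType) (M : metricType R) (T : M -> M)
    (A B C H E : R) : hardy_rogers T A B C H E ->
  exists2 k, 0 <= k < 1 &
    forall x, mdist (T x) (T (T x)) <= k * mdist x (T x).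
Proof.
move=> [[A0 B0 C0 H0 E0] sum_lt1 contr].
have den_gt0 : 0 < 2 - (B + C + H + E) by lra.
exists ((2 * A + B + C + H + E) / (2 - (B + C + H + E))).
  have num_ge0 : 0 <= 2 * A + B + C + H + E by lra.
  rewrite divr_ge0//= ?(ltW den_gt0)// ltr_pdivrMr// mul1r.
  by lra.
move=> x; rewrite mulrAC ler_pdivlMr//.
have := contr x (T x); have := contr (T x) x; rewrite !mdistxx.
rewrite !(metric_sym (T x) x) !(metric_sym (T (T x))).
(* The distance from [x] to [T (T x)] enters one inequality with factor [H] and the other with
   factor [E]. *)
have tri := metric_triangle x (T x) (T (T x)).
have := ler_wpM2l H0 tri; have := ler_wpM2l E0 tri.
by lra.
Qed.

(** Consecutive distances decay like [k ^+ n], so this is the geometric tail bound, uniform in [m].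
    After multiplying by [1 - k], the induction on [m] uses only
    [(1 - k) * k ^+ n + k ^+ n.+1 = k ^+ n]. *)
Lemma iter_dist_le (R : realType) (M : metricType R) (T : M -> M) (k : R)
    (x : M) (n m : nat) : 0 <= k < 1 ->
  (forall x, mdist (T x) (T (T x)) <= k * mdist x (T x)) ->
  mdist (iter n T x) (iter (n + m) T x) <=
    k ^+ n * (mdist x (T x) / (1 - k)).
Proof.
move=> /andP[k0 k1] step.
have step_iter i : mdist (iter i T x) (iter i.+1 T x) <= k ^+ i * mdist x (T x).
  elim: i => [|i IHi]; first by rewrite expr0 mul1r.
  apply: le_trans (step _) _.
  by rewrite exprS -mulrA ler_wpM2l.
rewrite mulrA ler_pdivlMr ?subr_gt0//.
elim: m n => [|m IHm] n.
  by rewrite addn0 mdistxx mul0r mulr_ge0 ?exprn_ge0 ?mdist_ge0.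
have tri := metric_triangle (iter n T x) (iter n.+1 T x) (iter (n + m.+1) T x).
have {IHm} := IHm n.+1; rewrite addSnnS exprS => IHm.
have k1' : 0 <= 1 - k by rewrite subr_ge0 ltW.
have := ler_wpM2r k1' tri; have := ler_wpM2r k1' (step_iter n).
by lra.
Qed.

Lemma iter_cauchy (R : realType) (M : metricType R) (T : M -> M) (k : R)
    (x : M) : 0 <= k < 1 ->
  (forall x, mdist (T x) (T (T x)) <= k * mdist x (T x)) ->
  cauchy ((fun n => iter n T x) @ \oo).
Proof.
move=> k01 step; apply: cauchy_exP => e e0.
have k1 : `|k| < 1 by case/andP: k01 => k0 ?; rewrite ger0_norm.
have /cvgrPdist_lt/(_ _ e0) := cvg_geometric (mdist x (T x) / (1 - k)) k1.
case=> N _ /(_ N (leqnn N)); rewrite /= sub0r normrN => small.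
(* By [cauchy_exP] it suffices that one ball of radius [e] contains a tail of the orbit; [N] makes
   the tail bound less than [e]. *)
exists (iter N T x); exists N => // n /= Nn.
rewrite ballEmdist /=; apply: le_lt_trans small.
rewrite mulrC; apply: le_trans (ler_norm _).
by rewrite -{1}(subnKC Nn); exact: iter_dist_le.
Qed.

(** [T] is not assumed continuous, so [mdist y (T y)] is bounded through the contraction inequality
    at [(z, y)] for a late iterate [z]. *)
Lemma hardy_rogers_limit_fixed (R : realType) (M : metricType R) (T : M -> M)
    (A B C H E : R) (x y : M) : hardy_rogers T A B C H E ->
  (fun n => iter n T x) @ \oo --> y -> T y = y.
Proof.
move=> [[A0 B0 C0 H0 E0] sum_lt1 contr] xy; apply/esym/mdist_positivity/eqP.
rewrite eq_le mdist_ge0 andbT.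
apply/ler_addgt0Pr => e e0; rewrite add0r.
(* With [z] and [T z] within [d] of [y], the inequality becomes [(1 - C - H) * mdist y (T y) <= (1 +
   A + 2 * B + H + E) * d], and the last factor of [d] is at most 3. *)
pose d := (1 - C - H) * e / 3.
have p0 : 0 < 1 - C - H by lra.
have d0 : 0 < d by rewrite divr_gt0 ?mulr_gt0.
have /metricType_numDomainType.cvgrPdist_lt/(_ _ d0)[N _ near_y] := xy.
set z := iter N T x.
have yz : mdist y z < d by exact: near_y (leqnn N).
have yTz : mdist y (T z) < d by exact: near_y (leqnSn N).
have d3 : d * 3 = (1 - C - H) * e by rewrite divfK.
have yTy := metric_triangle y (T z) (T y).
have zTz := metric_triangle z y (T z).
have zTy := metric_triangle z y (T y).
have := contr z y; rewrite !(metric_sym z y) in zTz zTy *.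
have := ler_wpM2l A0 (ltW yz); have := ler_wpM2l E0 (ltW yTz).
have := ler_wpM2l B0 zTz; have := ler_wpM2l H0 zTy.
have := ler_wpM2l B0 (ltW yz); have := ler_wpM2l B0 (ltW yTz).
have := ler_wpM2l H0 (ltW yz).
have : (A + 2 * B + H + E) * d <= 2 * d.
  by apply: ler_wpM2r; [exact: ltW | lra].
move=> *; rewrite -(ler_pM2l p0); lra.
Qed.

Lemma hardy_rogers_fixed_unique (R : realType) (M : metricType R) (T : M -> M)
    (A B C H E : R) (x y : M) : hardy_rogers T A B C H E ->
  T x = x -> T y = y -> x = y.
Proof.
move=> [[A0 B0 C0 H0 E0] sum_lt1 contr] Tx Ty.
apply/mdist_positivity/eqP; rewrite eq_le mdist_ge0 andbT.
(* At two fixed points the [B] and [C] terms vanish, leaving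
   [mdist x y <= (A + H + E) * mdist x y]. *)
have := contr x y; rewrite Tx Ty !mdistxx (metric_sym y x) => le.
have p0 : 0 < 1 - (A + H + E) by lra.
by rewrite -(ler_pM2l p0); lra.
Qed.

Lemma hardy_rogers_fixed_stability (R : realType) (M : metricType R)
    (T : M -> M) (A B C H E : R) (x y : M) (eta : R) :
  hardy_rogers T A B C H E -> T x = x -> mdist (T y) y <= eta ->
  mdist x y <= (1 + C + H) / (1 - (A + H + E)) * eta.
Proof.
move=> [[A0 B0 C0 H0 E0] sum_lt1 contr] Tx ye.
rewrite mulrAC ler_pdivlMr; last lra.
have tri1 := metric_triangle x (T y) y.
have := contr x y; rewrite Tx mdistxx (metric_sym y x) (metric_sym y (T y)).
(* Expanding the [H] term through [y] puts [H] both in the denominator and in the factor of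
   [eta]. *)
have tri2 := metric_triangle x y (T y); rewrite (metric_sym y) in tri2.
have := ler_wpM2l H0 tri2; have := ler_wpM2l C0 ye; have := ler_wpM2l H0 ye.
by lra.
Qed.

Theorem theorem3p20 (R : realType) (X : perturbedMetricSpace R)
  (hX : pms_complete X) (T : X -> X)
  (a b c h e : R)
  (ha : 0 <= a) (hb : 0 <= b) (hc : 0 <= c) (hh : 0 <= h) (he : 0 <= e)
  (hT : forall x y : X,
    pms_D (T x) (T y) <=
      a * pms_D x y + b * pms_D x (T x) + c * pms_D y (T y)
      + h * pms_D x (T y) + e * pms_D y (T x))
  (a0 b0 c0 h0 e0 : R)
  (ha0 : 0 <= a0) (hb0 : 0 <= b0) (hc0 : 0 <= c0) (hh0 : 0 <= h0)
  (he0 : 0 <= e0)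
  (hP : forall x y : X,
    a * pms_P x y + b * pms_P x (T x) + c * pms_P y (T y)
      + h * pms_P x (T y) + e * pms_P y (T x) <=
    a0 * exact_dist x y + b0 * exact_dist x (T x) + c0 * exact_dist y (T y)
      + h0 * exact_dist x (T y) + e0 * exact_dist y (T x))
  (hsum : (a + a0) + (b + b0) + (c + c0) + (h + h0) + (e + e0) < 1) :
  let A := a + a0 in
  let C := c + c0 in
  let H := h + h0 in
  let E := e + e0 in
  exists xstar : X,
    unique (fun x : X => T x = x) xstar /\
    forall (Tt : X -> X) (xt : X) (eta : R),
      Tt xt = xt ->
      (ereal_sup [set (pms_D (T x) (Tt x))%:E | x in [set: X]] <= eta%:E)%E ->
      exact_dist xstar xt <= (1 + C + H) / (1 - (A + H + E)) * eta.
Proof.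
move=> A C H E; set B := b + b0.
have dleD (x y : X) : exact_dist x y <= pms_D x y.
  by rewrite /exact_dist gerBl pms_P_ge0.
have hr : hardy_rogers T A B C H E.
  split=> //; first by split; rewrite addr_ge0.
  move=> x y; rewrite !mdist_exact; apply: le_trans (dleD _ _) _.
  (* Writing D = d + P on the right of [hT], the P-part is exactly the left side of [hP]. *)
  have := hP x y; have := hT x y; rewrite /A /B /C /H /E /exact_dist.
  by lra.
have [k k01 step] := hardy_rogers_step hr.
case: (pms_nonempty X) => x0.
have [xs xsP] := hX _ _ (iter_cauchy x0 k01 step).
exists xs; have Txs := hardy_rogers_limit_fixed hr xsP; split.
  by split=> // y Ty; exact: hardy_rogers_fixed_unique hr Txs Ty.
move=> Tt xt eta Txt supD; rewrite -mdist_exact.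
apply: (hardy_rogers_fixed_stability hr) => //.
rewrite mdist_exact; apply: le_trans (dleD _ _) _.
(* Replacing the second [xt] by [Tt xt] turns the left side into a member of the set under the
   supremum. *)
rewrite -lee_fin -{2}Txt; apply: le_trans supD.
by apply: ereal_sup_ubound; exists xt.
Qed.
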